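(* Let $S$ be a ring which is epsilon-strongly graded by a finite group $G$ and put $R=S_e$. Then $S/R$ is a Frobenius extension.
   Context: Rings are associative with a nonzero multiplicative identity $1$. For additive subgroups $X,Y\subseteq S$, $XY$ denotes the set of finite sums of products $xy$ with $x\in X$, $y\in Y$. Let $G$ be a group with identity $e$. $S$ is graded by $G$ if there are additive subgroups $S_g\subseteq S$ ($g\in G$) with $S=\bigoplus_{g\in G}S_g$ and $S_gS_h\subseteq S_{gh}$ for all $g,h\in G$; $R=S_e$. An ideal of $R$ is called unital if it has its own multiplicative identity element (allowed to be $0$). $S$ is epsilon-strongly graded by $G$ if for each $g\in G$, $S_gS_{g^{-1}}$ is a unital ideal of $R$, and for all $g,h\in G$ the equalities $S_gS_h = S_gS_{g^{-1}}S_{gh} = S_{gh}S_{h^{-1}}S_h$ hold. $S/R$ is a Frobenius extension if there are a finite set $J$, elements $x_j,y_j\in S$ for $j\in J$, and an $R$-bimodule map $E:S\to R$ such that for every $s\in S$ the equalities $s=\sum_{j\in J}x_jE(y_js)=\sum_{j\in J}E(sx_j)y_j$ hold. *)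

(* Defs.v *)
From HB Require Import structures.
From mathcomp Require Import all_boot all_order all_algebra all_fingroup.
From mathcomp Require Import boolp classical_sets.

Set Implicit Arguments.
Unset Strict Implicit.
Unset Printing Implicit Defensive.

Import GRing.Theory.
Local Open Scope ring_scope.
Local Open Scope classical_set_scope.

Definition prodset (S : nzRingType) (X Y : set S) : set S :=
  [set s | exists n (x y : 'I_n -> S),
     [/\ forall i, X (x i), forall i, Y (y i) & s = \sum_(i < n) x i * y i]].

(* Internal direct sum over a possibly infinite index group: the components
   span S by finite sums, and a finite sum of elements from pairwise distinct
   components vanishes only if all its terms do. *)
Definition direct_sum (S : nzRingType) (G : groupType) (A : G -> set S) : Prop :=
  (forall s : S, exists (l : seq G) (a : G -> S),
     [/\ uniq l, forall g, A g (a g) & s = \sum_(g <- l) a g]) /\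
  (forall (l : seq G) (a : G -> S),
     uniq l -> (forall g, A g (a g)) -> \sum_(g <- l) a g = 0 ->
     forall g, g \in l -> a g = 0).

Definition graded (S : nzRingType) (G : groupType) (A : G -> set S) : Prop :=
  [/\ forall g, zmod_closed (mem (A g)),
      direct_sum A &
      forall g h, prodset (A g) (A h) `<=` A (g * h)%g].

Definition ideal_of (S : nzRingType) (R I : set S) : Prop :=
  [/\ I `<=` R,
      zmod_closed (mem I),
      forall r x, R r -> I x -> I (r * x) &
      forall r x, R r -> I x -> I (x * r)].

Definition unital_ideal_of (S : nzRingType) (R I : set S) : Prop :=
  ideal_of R I /\
  exists2 u, I u & forall x, I x -> u * x = x /\ x * u = x.

Definition epsilon_strongly_graded (S : nzRingType) (G : groupType)
    (A : G -> set S) : Prop :=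
  [/\ graded A,
      forall g, unital_ideal_of (A 1%g) (prodset (A g) (A g^-1%g)) &
      forall g h,
        prodset (A g) (A h)
          = prodset (prodset (A g) (A g^-1%g)) (A (g * h)%g) /\
        prodset (A g) (A h)
          = prodset (prodset (A (g * h)%g) (A h^-1%g)) (A h)].

(* An R-bimodule map S -> R, represented as a self-map of S with values in R. *)
Definition bimodule_map (S : nzRingType) (R : set S) (E : S -> S) : Prop :=
  [/\ forall s, R (E s),
      forall s t, E (s + t) = E s + E t,
      forall r s, R r -> E (r * s) = r * E s &
      forall r s, R r -> E (s * r) = E s * r].

(* The first conjunct is what makes S/R a ring extension. *)
Definition frobenius_extension (S : nzRingType) (R : set S) : Prop :=
  subring_closed (mem R) /\
  exists (J : finType) (x y : J -> S) (E : S -> S),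
    bimodule_map R E /\
    forall s : S, s = \sum_(j : J) x j * E (y j * s) /\
                  s = \sum_(j : J) E (s * x j) * y j.

(* Main.v *)
Require Import Defs.
From mathcomp Require Import all_boot all_order all_algebra all_fingroup.
From mathcomp Require Import boolp classical_sets.

(** Let [s = \sum_g s_g] be the decomposition of [s] into homogeneous
    components and let [E s := s_1] be the projection onto [R = A 1]; it is a
    map of [R]-bimodules because multiplying by [R] preserves every degree
    ([component1_mull], [component1_mulr]).

    Write the identity [eps_g] of the ideal [A g * A g^-1] as a finite sum
    [\sum_i u_(g,i) * v_(g,i)] with [u_(g,i)] in [A g] and [v_(g,i)] in
    [A g^-1].  The [u_(g,i)] and [v_(g,i)], for all [g] in the finite group and
    all [i], are the required dual families.  Indeed [v_(g,i)] shifts degree [g]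
    to degree [1], so [E (v_(g,i) * s) = v_(g,i) * s_g] and
      [\sum_(g,i) u_(g,i) * E (v_(g,i) * s) = \sum_g eps_g * s_g],
    while symmetrically
      [\sum_(g,i) E (s * u_(g,i)) * v_(g,i) = \sum_g s_(g^-1) * eps_g].
    Both sums are [s], provided that [eps_g] acts as the identity on [A g] from
    the left and on [A g^-1] from the right.  This is where the epsilon-strong
    condition enters: as [1] lies in [R], its case with first index [1] reads
    [A h = A h * A h^-1 * A h] ([homogeneous_factor]), so that every element of
    [A h] is a sum of products with left factor in [A h * A h^-1] and, after
    regrouping, a sum of products with right factor in [A h^-1 * A h]
    ([unit_fixl], [unit_fixr]). *)

Set Implicit Arguments.
Unset Strict Implicit.
Unset Printing Implicit Defensive.

Import GRing.Theory.
Local Open Scope ring_scope.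
Local Open Scope classical_set_scope.

Lemma mem_prodset (S : nzRingType) (X Y : set S) (a b : S) :
  X a -> Y b -> prodset X Y (a * b).
Proof.
move=> Xa Yb; exists 1%N, (fun=> a), (fun=> b); split=> //.
by rewrite big_ord1.
Qed.

Lemma sum_tagged (S : nzRingType) (I : finType) (J : I -> finType)
    (F : forall i, J i -> S) :
  \sum_(p : {i : I & J i}) F (tag p) (tagged p) = \sum_i \sum_j F i j.
Proof. by rewrite sig_big_dep. Qed.

Section Graded.
Variables (S : nzRingType) (G : finGroupType) (A : G -> set S).
Hypothesis grA : graded A.

Lemma homogeneous0 g : A g 0.
Proof. by case: grA => cl _ _; have [+ _] := cl g; rewrite inE. Qed.

Lemma homogeneousB g a b : A g a -> A g b -> A g (a - b).
Proof.
case: grA => cl _ _ Aa Ab; have [_ /(_ a b)] := cl g.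
by rewrite !inE; apply.
Qed.

Lemma homogeneousD g a b : A g a -> A g b -> A g (a + b).
Proof.
move=> Aa Ab; rewrite -[b]opprK; apply: homogeneousB => //.
by rewrite -sub0r; apply: homogeneousB => //; apply: homogeneous0.
Qed.

Lemma homogeneousM g h a b : A g a -> A h b -> A (g * h)%g (a * b).
Proof. by case: grA => _ _ + Aa Ab; apply; apply: mem_prodset. Qed.

Lemma component_exists s :
  exists a : G -> S, (forall g, A g (a g)) /\ s = \sum_g a g.
Proof.
case: grA => _ [/(_ s)[l [a [ul Aa ->]]] _] _.
exists (fun g => if g \in l then a g else 0); split=> [g|].
  by case: ifP => _ //; apply: homogeneous0.
by rewrite -big_mkcond /= big_uniq.
Qed.

Definition component (s : S) : G -> S := projT1 (cid (component_exists s)).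

Lemma component_homogeneous s g : A g (component s g).
Proof. by rewrite /component; case: cid => a []. Qed.

Lemma sum_component s : \sum_g component s g = s.
Proof. by rewrite /component; case: cid => a []. Qed.

Lemma component_unique s (a : G -> S) g :
  (forall h, A h (a h)) -> s = \sum_h a h -> component s g = a g.
Proof.
move=> Aa sE; case: grA => _ [_ indep] _.
apply/eqP; rewrite -subr_eq0; apply/eqP.
apply: (indep (index_enum G) (fun h => component s h - a h)).
- exact: index_enum_uniq.
- by move=> h; apply: homogeneousB => //; apply: component_homogeneous.
- by rewrite sumrB sum_component -sE subrr.
- exact: mem_index_enum.
Qed.

Lemma componentD s t g : component (s + t) g = component s g + component t g.
Proof.
apply: (@component_unique _ (fun h => component s h + component t h)).
  by move=> h; apply: homogeneousD; apply: component_homogeneous.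
by rewrite big_split /= !sum_component.
Qed.

(** Left multiplication by [a] in [A h] carries degree [h^-1 * k] to degree
    [k], so the components of [s], multiplied by [a] and relabelled, decompose
    [a * s]; uniqueness does the rest. *)
Lemma component_mull h a s g :
  A h a -> component (a * s) g = a * component s (h^-1 * g)%g.
Proof.
move=> Aa.
apply: (@component_unique _ (fun k => a * component s (h^-1 * k)%g)).
  move=> k; rewrite -{1}(mulKVg h k).
  by apply: homogeneousM => //; apply: component_homogeneous.
rewrite -mulr_sumr -{1}(sum_component s); congr (_ * _).
by rewrite (reindex_inj (mulgI h^-1%g)).
Qed.

Lemma component_mulr h a s g :
  A h a -> component (s * a) g = component s (g * h^-1)%g * a.
Proof.
move=> Aa.
apply: (@component_unique _ (fun k => component s (k * h^-1)%g * a)).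
  move=> k; rewrite -{1}(mulgKV h k).
  by apply: homogeneousM => //; apply: component_homogeneous.
rewrite -mulr_suml -{1}(sum_component s); congr (_ * _).
by rewrite (reindex_inj (mulIg h^-1%g)).
Qed.

Lemma component1_mull h a s :
  A h a -> component (a * s) 1%g = a * component s h^-1%g.
Proof. by move=> /component_mull->; rewrite mulg1. Qed.

Lemma component1_mulr h a s :
  A h a -> component (s * a) 1%g = component s h^-1%g * a.
Proof. by move=> /component_mulr->; rewrite mul1g. Qed.

Lemma component_id g s : A g s -> component s g = s.
Proof.
move=> As; rewrite (@component_unique _ (fun h => if h == g then s else 0)).
- by rewrite eqxx.
- by move=> h; case: eqP => [->|_] //; apply: homogeneous0.
- by rewrite -big_mkcond /= big_pred1_eq.
Qed.

(** Comparing the components of degree [g] in [1 * s = s] for [s] in [A g]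
    shows that [component 1 1] is a left identity on homogeneous elements,
    hence on all of [S]; so it equals [1]. *)
Lemma homogeneous1 : A 1%g 1.
Proof.
have e_id s : component 1 1%g * s = s.
  rewrite -{2}(sum_component s) -{1}(sum_component s) mulr_sumr.
  apply: eq_bigr => g _; have As := component_homogeneous s g.
  rewrite -[RHS](component_id As) -[in RHS](mul1r (component s g)).
  by rewrite (component_mulr _ _ As) mulgV.
by rewrite -(e_id 1) mulr1; apply: component_homogeneous.
Qed.

Lemma graded_subring_closed : subring_closed (mem (A 1%g)).
Proof.
split; first by rewrite inE; apply: homogeneous1.
  by move=> a b; rewrite !inE; apply: homogeneousB.
by move=> a b; rewrite !inE -{3}(mulg1 1%g); apply: homogeneousM.
Qed.

Lemma component1_bimodule_map : bimodule_map (A 1%g) (component^~ 1%g).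
Proof.
split=> [s|s t|r s Rr|r s Rr]; first exact: component_homogeneous.
- exact: componentD.
- by rewrite (component1_mull _ Rr) invg1.
- by rewrite (component1_mulr _ Rr) invg1.
Qed.

End Graded.

Section EpsilonStrong.
Variables (S : nzRingType) (G : finGroupType) (A : G -> set S).
Hypothesis hA : epsilon_strongly_graded A.

Let grA : graded A. Proof. by case: hA. Qed.

(** The defining equality [A 1 * A g = A g * A g^-1 * A g], read on
    [s = 1 * s]. *)
Lemma homogeneous_factor g s :
  A g s -> prodset (prodset (A g) (A g^-1%g)) (A g) s.
Proof.
case: hA => _ _ /(_ 1%g g)[_ +] As; rewrite mul1g => <-.
by rewrite -(mul1r s); apply: mem_prodset => //; apply: homogeneous1.
Qed.

Lemma unit_fixl g u s :
  (forall x, prodset (A g) (A g^-1%g) x -> u * x = x) ->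
  A g s -> u * s = s.
Proof.
move=> uP /homogeneous_factor[n [x [c [Px _ ->]]]].
by rewrite mulr_sumr; apply: eq_bigr => i _; rewrite mulrA uP.
Qed.

Lemma unit_fixr g u s :
  (forall x, prodset (A g) (A g^-1%g) x -> x * u = x) ->
  A g^-1%g s -> s * u = s.
Proof.
move=> uP /homogeneous_factor[n [x [c [Px Ac ->]]]].
rewrite mulr_suml; apply: eq_bigr => i _.
(* Expand the left factor and regroup, so that [u] meets the ideal
   [A g * A g^-1] on the right. *)
have [m [a [b [_ + ->]]]] := Px i; rewrite invgK => Ab.
rewrite mulr_suml mulr_suml; apply: eq_bigr => j _.
by rewrite -!(mulrA (a j)) uP //; apply: mem_prodset.
Qed.

(** Only these absorption properties of [eps_g] enter the two reconstruction
    formulas; the pairs [f i] present [eps_g] as a sum of products. *)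
Lemma local_dual_family g :
  exists n (f : 'I_n -> S * S),
    [/\ forall i, A g (f i).1, forall i, A g^-1%g (f i).2,
        forall s, A g s -> (\sum_i (f i).1 * (f i).2) * s = s &
        forall s, A g^-1%g s -> s * (\sum_i (f i).1 * (f i).2) = s].
Proof.
case: hA => _ /(_ g)[_ [u [n [x [y [Ax Ay uE]]]] uP]] _.
exists n, (fun i => (x i, y i)); rewrite /= -uE; split=> //.
  by move=> s; apply: unit_fixl => t /uP[].
by move=> s; apply: unit_fixr => t /uP[].
Qed.

End EpsilonStrong.

Theorem theorem24 (S : nzRingType) (G : finGroupType) (A : G -> set S)
    (hA : epsilon_strongly_graded A) :
  frobenius_extension (A 1%g).
Proof.
have grA : graded A by case: hA.
split; first exact: graded_subring_closed.
have [n nP] := choice (local_dual_family hA).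
pose f g : 'I_(n g) -> S * S := projT1 (cid (nP g)).
have fP g := projT2 (cid (nP g)).
exists {g : G & 'I_(n g)}, (fun p => (f _ (tagged p)).1),
  (fun p => (f _ (tagged p)).2), ((component grA)^~ 1%g).
split=> [|s]; first exact: component1_bimodule_map.
split.
- rewrite (sum_tagged
    (fun g i => (f g i).1 * component grA ((f g i).2 * s) 1%g)) /=.
  rewrite -[LHS](sum_component grA s); apply: eq_bigr => g _.
  have [_ f2 fl _] := fP g.
  rewrite -[LHS]fl; last exact: component_homogeneous.
  rewrite mulr_suml; apply: eq_bigr => i _.
  by rewrite (component1_mull _ _ (f2 i)) invgK mulrA.
- rewrite (sum_tagged
    (fun g i => component grA (s * (f g i).1) 1%g * (f g i).2)) /=.
  (* Here [f g] reproduces the component of degree [g^-1], so the components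
     of [s] are summed in that order. *)
  rewrite -[LHS](sum_component grA s) (reindex_inj (@invg_inj G)).
  apply: eq_bigr => g _; have [f1 _ _ fr] := fP g.
  rewrite -[LHS]fr; last exact: component_homogeneous.
  rewrite mulr_sumr; apply: eq_bigr => i _.
  by rewrite (component1_mulr _ _ (f1 i)) mulrA.
Qed.
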